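(* Let $A,A'\in\mathbb{C}^{n\times n}$ with $\|A\|,\|A'\|\le1$ and $\|A-A'\|\le\delta$, and let $\{(v_i,\lambda_i)\}_{i\le n}$ and $\{(v_i',\lambda_i')\}_{i\le n}$ be eigenpairs of $A$ and $A'$ respectively, each with distinct eigenvalues. If $\delta<\frac{\mathrm{gap}(A)}{8\kappa_V(A)}$, then, for a suitable ordering of the eigenpairs and after possibly multiplying the $v_i$ by phases, $$\|v_i'-v_i\|\le 2n\,\kappa_{\mathrm{eig}}(A)\,\delta\qquad\text{and}\qquad|\lambda_i'-\lambda_i|\le\kappa_V(A)\,\delta\le2\kappa_{\mathrm{eig}}(A)\,\delta\qquad\text{for all }i=1,\dots,n.$$
   Context: $\|\cdot\|$ is the spectral norm on matrices and Euclidean norm on vectors. Eigenpairs $(v,\lambda)$ satisfy $Av=\lambda v$ with $\|v\|=1$. $\kappa_V(A):=\inf_V\|V\|\|V^{-1}\|$ over invertible $V$ with $A=VDV^{-1}$ for some diagonal $D$; $\mathrm{gap}(A):=\min_{i\ne j}|\lambda_i(A)-\lambda_j(A)|$; $\kappa_{\mathrm{eig}}(A):=\kappa_V(A)/\mathrm{gap}(A)$. *)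

(* Defs.v *)
From mathcomp Require Import all_boot all_order all_algebra all_fingroup.
From mathcomp Require Import complex.
From mathcomp Require Import boolp classical_sets reals.

Set Implicit Arguments.
Unset Strict Implicit.
Unset Printing Implicit Defensive.

Import Order.TTheory GRing.Theory Num.Theory.

Local Open Scope ring_scope.
Local Open Scope complex_scope.
Local Open Scope classical_set_scope.

(* [`|z|] is itself an element of [R[i]]; [ComplexField.normc z : R] is the
   same modulus, taken in the ordered field [R]. *)
Notation cmod := (@ComplexField.Normc.normc _).

Definition l2norm (R : realType) (n : nat) (x : 'cV[R[i]]_n) : R :=
  Num.sqrt (\sum_(i < n) cmod (x i 0) ^+ 2).

Definition specnorm (R : realType) (n : nat) (A : 'M[R[i]]_n) : R :=
  sup [set l2norm (A *m x) | x in [set x : 'cV[R[i]]_n | l2norm x <= 1]].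

Definition diagonalizes (R : realType) (n : nat) (A V : 'M[R[i]]_n) : Prop :=
  V \in unitmx /\ exists d : 'rV[R[i]]_n, A = V *m diag_mx d *m invmx V.

(* The infimum is taken in [R], so it is 0 rather than +oo when [A] is not
   diagonalizable; a matrix with distinct eigenvalues is diagonalizable. *)
Definition kappaV (R : realType) (n : nat) (A : 'M[R[i]]_n) : R :=
  inf [set specnorm V * specnorm (invmx V) | V in [set V | diagonalizes A V]].

(* Roots of the characteristic polynomial, with multiplicity ([n] of them). *)
Definition eigvals (R : realType) (n : nat) (A : 'M[R[i]]_n) : seq R[i] :=
  sval (closed_field_poly_normal (char_poly A)).

(* For [n >= 2] this is a minimum over a nonempty finite set; for [n <= 1]
   there is no pair of eigenvalues and [gap A = inf set0 = 0]. *)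
Definition gap (R : realType) (n : nat) (A : 'M[R[i]]_n) : R :=
  inf [set g : R | exists i j : 'I_n,
         i != j /\ g = cmod ((eigvals A)`_i - (eigvals A)`_j)].

Definition kappa_eig (R : realType) (n : nat) (A : 'M[R[i]]_n) : R :=
  kappaV A / gap A.

Definition eigenpair (R : realType) (n : nat) (A : 'M[R[i]]_n)
    (v : 'cV[R[i]]_n) (lam : R[i]) : Prop :=
  A *m v = lam *: v /\ l2norm v = 1.

(* Main.v *)
Require Import Defs.
From mathcomp Require Import all_boot all_order all_algebra all_fingroup.
From mathcomp Require Import complex.
From mathcomp Require Import boolp classical_sets reals.
From mathcomp Require Import ring lra.

Set Implicit Arguments.
Unset Strict Implicit.
Unset Printing Implicit Defensive.

Import Order.TTheory GRing.Theory Num.Theory.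

Local Open Scope ring_scope.
Local Open Scope complex_scope.

(** Write [A = V D V^-1] with [D] diagonal, [k = |V| |V^-1|], and pass to the
    basis of columns of [V].  There [A'] becomes [D + E] with [|E| <= k delta],
    so an eigenvector [y] of [A'] for [mu] satisfies [(mu - d_j) y_j = (E y)_j]
    in every coordinate [j].  All estimates are read off this identity.

    - Eigenvalues ([bauer_fike]): [mu] cannot be further than [k delta] from
      every [d_j].  The eigenvalue of [A] closest to [mu] does not depend on [V],
      so the bound passes to the infimum over [V]: it is at most
      [kappaV A * delta], which is below [gap A / 8] ([bauer_fike_kappaV]).

    - Matching ([simple_eigenvalue_near]): sending each eigenvalue of [A'] to its
      closest eigenvalue of [A] is injective, hence a permutation.  If [mu] and
      [nu] both chose [d_i], their eigenvectors are dominated by the coordinate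
      [i] and can be scaled to have it equal to 1; their difference [x] has no
      coordinate [i], so [D - nu] is large on it, while [(D - nu) x] is of size
      [eps |x|], where [eps = k delta].  So [x = 0], and this forces [mu = nu].

    - Eigenvectors ([eigenvector_near]): the coordinates [j != i] of [y] are those
      of [E y] divided by [mu - d_j], so after going back through [V] the unit
      eigenvector of [A'] is within [k delta / h] of the line of [v_i], where [h]
      bounds [|mu - d_j|] from below.  Replacing that multiple of [v_i] by a unit
      multiple at most doubles the distance ([phase_align]).

    One basis [V] with [k <= 3/2 kappaV A] serves for the last two items; with
    [h = 7/8 gap A] the vector bound is [24/7 kappa_eig A * delta], which is at
    most [2 n kappa_eig A * delta] because [n >= 2].  That [n >= 2], that [gap A]
    and [kappaV A] are positive, and that [A] is diagonalizable all follow from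
    [0 <= delta < gap A / (8 kappaV A)], since otherwise the right-hand side is
    not positive under the conventions [inf set0 = 0] and [x / 0 = 0]. *)

(** * The Euclidean norm and the spectral norm *)

Section Norms.
Variable R : realType.
Implicit Types (z w : R[i]) (n : nat).

Lemma cmod_ge0 z : 0 <= cmod z.
Proof. by case: z => a b; apply: sqrtr_ge0. Qed.

Lemma cmodD z w : cmod (z + w) <= cmod z + cmod w.
Proof. exact: le_normcD. Qed.

Lemma cmodM z w : cmod (z * w) = cmod z * cmod w.
Proof. exact: ComplexField.Normc.normcM. Qed.

Lemma cmodN z : cmod (- z) = cmod z.
Proof. exact: normcN. Qed.

Lemma cmodB z w : cmod (z - w) = cmod (w - z).
Proof. by rewrite -cmodN opprB. Qed.

Lemma cmod_real (a : R) : cmod a%:C = `|a|.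
Proof. by rewrite /= expr0n addr0 sqrtr_sqr. Qed.

Lemma cmod0 : cmod (0 : R[i]) = 0.
Proof. exact: ComplexField.Normc.normc0. Qed.

Lemma cmod_eq0 z : (cmod z == 0) = (z == 0).
Proof.
apply/eqP/eqP => [|->]; last exact: cmod0.
exact: ComplexField.Normc.eq0_normc.
Qed.

Lemma cmod_triangle (x y z : R[i]) : cmod (x - z) <= cmod (x - y) + cmod (y - z).
Proof. by rewrite -(subrKA y x (- z)); exact: cmodD. Qed.

Lemma l2norm_ge0 n (x : 'cV[R[i]]_n) : 0 <= l2norm x.
Proof. exact: sqrtr_ge0. Qed.

Lemma sqr_l2norm n (x : 'cV[R[i]]_n) :
  l2norm x ^+ 2 = \sum_(i < n) cmod (x i 0) ^+ 2.
Proof. by rewrite sqr_sqrtr// sumr_ge0// => i _; rewrite sqr_ge0. Qed.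

Lemma l2norm_le n (x : 'cV[R[i]]_n) (b : R) : 0 <= b ->
  \sum_(i < n) cmod (x i 0) ^+ 2 <= b ^+ 2 -> l2norm x <= b.
Proof.
by move=> b0 h; rewrite -(@ler_pXn2r _ 2%N) ?nnegrE ?l2norm_ge0// sqr_l2norm.
Qed.

Lemma l2norm_eq0 n (x : 'cV[R[i]]_n) : l2norm x = 0 -> x = 0.
Proof.
move=> x0; have := sqr_l2norm x; rewrite x0 expr0n /= => /esym/eqP.
rewrite psumr_eq0 => [/allP h|i _]; last exact: sqr_ge0.
apply/colP => i; rewrite mxE; apply/eqP; rewrite -cmod_eq0.
by have := h i (mem_index_enum _); rewrite /= sqrf_eq0.
Qed.

Lemma l2norm0 n : l2norm (0 : 'cV[R[i]]_n) = 0.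
Proof.
apply/eqP; rewrite -sqrf_eq0 sqr_l2norm big1// => i _.
by rewrite mxE cmod0 expr0n.
Qed.

Lemma l2norm_gt0 n (x : 'cV[R[i]]_n) : x != 0 -> 0 < l2norm x.
Proof.
by move=> x0; rewrite lt_def l2norm_ge0 andbT; apply: contraNneq x0 => /l2norm_eq0 ->.
Qed.

Lemma le_l2norm_scale n (x y : 'cV[R[i]]_n) (m : R) : 0 <= m ->
  (forall i, m * cmod (x i 0) <= cmod (y i 0)) -> m * l2norm x <= l2norm y.
Proof.
move=> m0 h; rewrite -(@ler_pXn2r _ 2%N) ?nnegrE ?mulr_ge0 ?l2norm_ge0//.
rewrite exprMn !sqr_l2norm mulr_sumr ler_sum// => i _.
by rewrite -exprMn lerXn2r ?nnegrE ?mulr_ge0 ?cmod_ge0.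
Qed.

Lemma l2normZ n (a : R[i]) (x : 'cV[R[i]]_n) : l2norm (a *: x) = cmod a * l2norm x.
Proof.
apply/eqP; rewrite -(@eqrXn2 _ 2%N) ?mulr_ge0 ?l2norm_ge0 ?cmod_ge0//.
rewrite exprMn !sqr_l2norm mulr_sumr; apply/eqP/eq_bigr => i _.
by rewrite mxE cmodM exprMn.
Qed.

Lemma l2normN n (x : 'cV[R[i]]_n) : l2norm (- x) = l2norm x.
Proof. by congr Num.sqrt; apply: eq_bigr => i _; rewrite mxE cmodN. Qed.

(** With [a = |x|] and [b = |y|], each entry satisfies
    [(p + q)^2 <= (1 + b/a) p^2 + (1 + a/b) q^2], the difference being
    [(b p - a q)^2 / (a b)]; these weights make the right-hand sides add up to
    [(a + b)^2]. *)
Lemma l2normD n (x y : 'cV[R[i]]_n) : l2norm (x + y) <= l2norm x + l2norm y.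
Proof.
have [->|/l2norm_gt0 X0] := eqVneq x 0; first by rewrite add0r l2norm0 add0r.
have [->|/l2norm_gt0 Y0] := eqVneq y 0; first by rewrite addr0 l2norm0 addr0.
set a := l2norm x in X0 *; set b := l2norm y in Y0 *.
apply: l2norm_le; first lra.
have -> : (a + b) ^+ 2 = (1 + b / a) * a ^+ 2 + (1 + a / b) * b ^+ 2.
  by field; rewrite !gt_eqF.
rewrite !sqr_l2norm !mulr_sumr -big_split/=; apply: ler_sum => i _.
rewrite mxE; set p := cmod (x i 0); set q := cmod (y i 0).
apply: (@le_trans _ _ ((p + q) ^+ 2)).
  by rewrite lerXn2r ?nnegrE ?addr_ge0 ?cmod_ge0// cmodD.
have -> : (1 + b / a) * p ^+ 2 + (1 + a / b) * q ^+ 2 =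
  (p + q) ^+ 2 + (b * p - a * q) ^+ 2 / (a * b).
  by field; rewrite !gt_eqF.
by rewrite lerDl divr_ge0 ?sqr_ge0// mulr_ge0// ltW.
Qed.

Lemma l2norm_sum n (I : finType) (F : I -> 'cV[R[i]]_n) :
  l2norm (\sum_i F i) <= \sum_i l2norm (F i).
Proof.
apply: (big_ind2 (fun x b => l2norm x <= b)) => // [|x1 b1 x2 b2 h1 h2].
  by rewrite l2norm0.
by apply: le_trans (l2normD _ _) _; rewrite lerD.
Qed.

Lemma cmod_le_l2norm n (x : 'cV[R[i]]_n) i : cmod (x i 0) <= l2norm x.
Proof.
rewrite -(@ler_pXn2r _ 2%N) ?nnegrE ?l2norm_ge0 ?cmod_ge0// sqr_l2norm.
by rewrite (bigD1 i)//= lerDl sumr_ge0// => j _; rewrite sqr_ge0.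
Qed.

(** Boundedness is what makes the supremum defining [specnorm] meaningful; the sum
    of the norms of the columns is a crude bound. *)
Lemma specnorm_has_ubound n (A : 'M[R[i]]_n) :
  has_ubound [set l2norm (A *m x) | x in [set x : 'cV[R[i]]_n | l2norm x <= 1]]%classic.
Proof.
exists (\sum_j l2norm (col j A)) => _ [x /= x1 <-].
have -> : A *m x = \sum_j x j 0 *: col j A.
  apply/colP => i; rewrite mxE summxE; apply: eq_bigr => j _.
  by rewrite !mxE mulrC.
apply: le_trans (l2norm_sum _) _; apply: ler_sum => j _.
rewrite l2normZ ler_piMl ?l2norm_ge0//.
exact: le_trans (cmod_le_l2norm _ _) x1.
Qed.

Lemma specnorm_ge0 n (A : 'M[R[i]]_n) : 0 <= specnorm A.
Proof.
apply: (ub_le_sup (specnorm_has_ubound A)); exists 0; last by rewrite mulmx0 l2norm0.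
by rewrite /= l2norm0.
Qed.

Lemma l2norm_mulmx n (A : 'M[R[i]]_n) (x : 'cV[R[i]]_n) :
  l2norm (A *m x) <= specnorm A * l2norm x.
Proof.
have [->|/l2norm_gt0 x0] := eqVneq x 0; first by rewrite mulmx0 l2norm0 mulr0.
have x1 : cmod ((l2norm x)^-1)%:C * l2norm x = 1.
  by rewrite cmod_real gtr0_norm ?invr_gt0// mulVf ?gt_eqF.
rewrite -ler_pdivrMr// mulrC.
have -> : (l2norm x)^-1 = cmod ((l2norm x)^-1)%:C.
  by rewrite cmod_real gtr0_norm ?invr_gt0.
rewrite -l2normZ -linearZ /=; apply: (ub_le_sup (specnorm_has_ubound A)).
by exists ((l2norm x)^-1%:C *: x) => //=; rewrite l2normZ x1.
Qed.

End Norms.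

(** * Eigenvalues, gap and diagonalizing bases *)

Section Spectrum.
Variables (R : realType) (n : nat).
Implicit Types (A V : 'M[R[i]]_n) (d : 'rV[R[i]]_n) (v : 'cV[R[i]]_n).

Lemma unit_vector_neq0 v : l2norm v = 1 -> v != 0.
Proof. by move=> v1; apply/eqP => v0; move: v1; rewrite v0 l2norm0; lra. Qed.

Lemma eigenpair_mem_eigvals A v lam : eigenpair A v lam -> lam \in eigvals A.
Proof.
case=> Av /unit_vector_neq0 v0.
have : eigenvalue A lam.
  rewrite /eigenvalue /eigenspace kermx_eq0 row_free_unit; apply: contra v0 => U.
  by rewrite -(mulKmx U v) mulmxBl Av mul_scalar_mx subrr mulmx0.
rewrite eigenvalue_root_char /eigvals; case: closed_field_poly_normal => s /= ->.
by rewrite (monicP (char_poly_monic A)) scale1r root_prod_XsubC.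
Qed.

Lemma size_eigvals A : size (eigvals A) = n.
Proof.
rewrite /eigvals; case: closed_field_poly_normal => s /= e.
have := size_char_poly A; rewrite e (monicP (char_poly_monic A)) scale1r.
by rewrite size_prod_XsubC => -[].
Qed.

Lemma gap_le A v w lam mu : eigenpair A v lam -> eigenpair A w mu ->
  lam != mu -> gap A <= cmod (lam - mu).
Proof.
move=> /eigenpair_mem_eigvals il /eigenpair_mem_eigvals im ne.
have hl : (index lam (eigvals A) < n)%N by rewrite -[X in (_ < X)%N](size_eigvals A) index_mem.
have hm : (index mu (eigvals A) < n)%N by rewrite -[X in (_ < X)%N](size_eigvals A) index_mem.
apply: ge_inf.
  by exists 0 => _ [i [j [_ ->]]]; apply: cmod_ge0.
exists (Ordinal hl), (Ordinal hm); rewrite /= !nth_index//; split=> //.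
by apply: contra ne => /eqP[/(congr1 (nth 0 (eigvals A)))]; rewrite !nth_index// => ->.
Qed.

(** This gives [n >= 2]: for smaller [n] the gap is the infimum of the empty
    set, which is 0. *)
Lemma gap_gt0_distinct A : 0 < gap A -> exists i j : 'I_n, i != j.
Proof.
rewrite /gap; set S := (X in inf X) => g0.
have [S0|/set0P[_ [i [j [ij _]]]]] := eqVneq S set0; last by exists i, j.
by move: g0; rewrite S0 inf0 ltxx.
Qed.

Lemma eigenpair_le_specnorm A v lam : eigenpair A v lam -> cmod lam <= specnorm A.
Proof.
case=> Av v1; have := l2norm_mulmx A v.
by rewrite Av l2normZ v1 !mulr1.
Qed.

(** The order of the diagonal entries depends on the basis [V]; the permutation
    [t] relates it to the given enumeration of the eigenvalues. *)
Lemma eigenvalues_of_diagonalization A V d (v : 'I_n -> 'cV[R[i]]_n)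
    (lam : 'I_n -> R[i]) : V \in unitmx -> A = V *m diag_mx d *m invmx V ->
  (forall i, eigenpair A (v i) (lam i)) -> injective lam ->
  exists t : {perm 'I_n}, forall i, d 0 (t i) = lam i.
Proof.
move=> UV eA hv hlam.
have /choice[t ht] : forall i, exists j, d 0 j = lam i.
  move=> i; have [Av /unit_vector_neq0 v0] := hv i.
  set y := invmx V *m v i.
  have ey : diag_mx d *m y = lam i *: y.
    by rewrite /y scalemxAr -Av eA !mulmxA mulVmx// mul1mx.
  have /matrix0Pn[j [k yj]] : y != 0.
    by apply: contra v0 => /eqP y0; rewrite -(mulKVmx UV (v i)) -/y y0 mulmx0.
  exists j; move: yj; rewrite ord1 => yj; apply: (mulIf yj).
  by have /colP/(_ j) := ey; rewrite mul_diag_mx !mxE.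
have tinj : injective t by move=> i j e; apply: hlam; rewrite -!ht e.
by exists (perm tinj) => i; rewrite permE.
Qed.

(** For unit vectors [||b| - 1| <= |u - b v|], and moving from [b] to its phase
    [b / |b|] costs exactly [||b| - 1|].  When [b = 0] the right-hand side is 2
    and every phase will do. *)
Lemma phase_align (u v : 'cV[R[i]]_n) (b : R[i]) : l2norm u = 1 -> l2norm v = 1 ->
  exists c, cmod c = 1 /\ l2norm (u - c *: v) <= 2 * l2norm (u - b *: v).
Proof.
move=> u1 v1.
have H : `|1 - cmod b| <= l2norm (u - b *: v).
  have h1 := l2normD (u - b *: v) (b *: v); have h2 := l2normD (b *: v - u) u.
  rewrite !subrK !l2normZ u1 v1 -(opprB u) l2normN in h1 h2.
  by rewrite ler_norml; lra.
have [b0|b0] := eqVneq b 0.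
  exists 1; rewrite ComplexField.Normc.normc1; split => //; rewrite b0 !scale0r scale1r subr0 u1.
  by apply: le_trans (l2normD _ _) _; rewrite l2normN u1 v1; lra.
have cb : 0 < cmod b by rewrite lt_def cmod_ge0 cmod_eq0 b0.
exists (b * ((cmod b)^-1)%:C).
have c1 : cmod (b * ((cmod b)^-1)%:C) = 1.
  by rewrite cmodM cmod_real gtr0_norm ?invr_gt0// mulfV ?gt_eqF.
split => //; set c := b * _.
rewrite -(subrKA (b *: v) u (- _)); apply: le_trans (l2normD _ _) _.
suff : l2norm (b *: v - c *: v) = `|1 - cmod b|.
  by move=> ->; rewrite mulr_natl mulr2n lerD2l.
have -> : b *: v - c *: v = (c * (cmod b - 1)%:C) *: v.
  rewrite -scalerBl; congr (_ *: _); rewrite /c -mulrA -rmorphM.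
  by rewrite /= mulrBr mulVf ?gt_eqF// mulr1 rmorphB /= mulrBr mulr1.
by rewrite l2normZ v1 mulr1 cmodM c1 mul1r cmod_real distrC.
Qed.

End Spectrum.

(** * Diagonal matrices under a small perturbation *)

Section Coordinates.
Variables (R : realType) (n : nat) (d : 'rV[R[i]]_n) (E : 'M[R[i]]_n) (eps : R).
Hypothesis hE : forall x : 'cV[R[i]]_n, l2norm (E *m x) <= eps * l2norm x.

(** The remainder [r] lets the same identity serve for eigenvectors and for the
    difference of two eigenvectors with different eigenvalues. *)
Lemma residual_entry (y r : 'cV[R[i]]_n) (mu : R[i]) j :
  diag_mx d *m y + E *m y = mu *: y + r ->
  (E *m y) j 0 = (mu - d 0 j) * y j 0 + r j 0.
Proof.
move=> /colP/(_ j); rewrite mul_diag_mx !mxE => e.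
by rewrite mulrBl addrAC -e addrAC subrr add0r.
Qed.

Lemma eigen_entry (y : 'cV[R[i]]_n) (mu : R[i]) j :
  diag_mx d *m y + E *m y = mu *: y -> (E *m y) j 0 = (mu - d 0 j) * y j 0.
Proof. by move=> e; rewrite (@residual_entry y 0 mu j) ?[X in _ + X]mxE addr0. Qed.

(** Otherwise [D - mu] would expand [y] by more than [E] can compensate. *)
Lemma bauer_fike (y : 'cV[R[i]]_n) (mu : R[i]) (m : R) : 0 <= m -> y != 0 ->
  diag_mx d *m y + E *m y = mu *: y ->
  (forall j, m <= cmod (mu - d 0 j)) -> m <= eps.
Proof.
move=> m0 /l2norm_gt0 y0 ey hm; rewrite -(ler_pM2r y0).
apply: le_trans (hE y); apply: le_l2norm_scale => // i.
by rewrite (eigen_entry _ ey) cmodM ler_wpM2r ?cmod_ge0.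
Qed.

Lemma off_component (y : 'cV[R[i]]_n) (mu : R[i]) (h : R) i : 0 <= h ->
  diag_mx d *m y + E *m y = mu *: y ->
  (forall j, j != i -> h <= cmod (mu - d 0 j)) ->
  h * l2norm (y - y i 0 *: delta_mx i 0) <= l2norm (E *m y).
Proof.
move=> h0 ey hd; apply: le_l2norm_scale => // j.
have [->|ji] := eqVneq j i.
  by rewrite !mxE !eqxx mulr1 subrr cmod0 mulr0 cmod_ge0.
rewrite (eigen_entry _ ey) !mxE (negPf ji) mulr0 subr0 cmodM.
by rewrite ler_wpM2r ?cmod_ge0// hd.
Qed.

Lemma l2norm_delta (i : 'I_n) : l2norm (delta_mx i 0 : 'cV[R[i]]_n) = 1.
Proof.
apply/eqP; rewrite -(@eqrXn2 _ 2%N) ?l2norm_ge0// sqr_l2norm.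
rewrite (bigD1 i)//= big1 => [|j ji]; last by rewrite mxE (negPf ji) cmod0 expr0n.
by rewrite mxE !eqxx ComplexField.Normc.normc1 addr0.
Qed.

(** The part of [y] off the coordinate [i] has norm at most
    [eps |y| / h <= |y| / 3], so the coordinate [i] carries at least [2/3] of
    the norm. *)
Lemma main_component (y : 'cV[R[i]]_n) (mu : R[i]) (h : R) i :
  0 <= eps -> 3 * eps < h ->
  diag_mx d *m y + E *m y = mu *: y ->
  (forall j, j != i -> h <= cmod (mu - d 0 j)) -> l2norm y <= 2 * cmod (y i 0).
Proof.
move=> e0 eh ey hd.
have hh : 0 <= h by lra.
have H1 := le_trans (off_component hh ey hd) (hE y).
have : l2norm y <= cmod (y i 0) + l2norm (y - y i 0 *: delta_mx i 0).
  rewrite -{1}(subrK (y i 0 *: delta_mx i 0) y) addrC.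
  by apply: le_trans (l2normD _ _) _; rewrite l2normZ l2norm_delta mulr1.
have := l2norm_ge0 (y - y i 0 *: delta_mx i 0).
have := cmod_ge0 (y i 0).
move: H1; set o := l2norm (_ - _); set Y := l2norm y; set c := cmod _.
nra.
Qed.

Lemma normalized_eigenvector (y : 'cV[R[i]]_n) (mu : R[i]) (h : R) i :
  0 <= eps -> 3 * eps < h -> y != 0 ->
  diag_mx d *m y + E *m y = mu *: y ->
  (forall j, j != i -> h <= cmod (mu - d 0 j)) ->
  exists u : 'cV[R[i]]_n,
    [/\ u i 0 = 1, l2norm u <= 2 & diag_mx d *m u + E *m u = mu *: u].
Proof.
move=> e0 eh /l2norm_gt0 y0 ey hmu.
have yb := main_component e0 eh ey hmu.
have yi : 0 < cmod (y i 0) by lra.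
have yi0 : y i 0 != 0 by rewrite -cmod_eq0 gt_eqF.
exists ((y i 0)^-1 *: y); split.
- by rewrite mxE mulVf.
- by rewrite l2normZ ComplexField.Normc.normcV mulrC ler_pdivrMr.
- by rewrite -!scalemxAr -scalerDr ey !scalerA mulrC.
Qed.

(** Normalize both eigenvectors to [u_i = w_i = 1] and put [x = w - u], so that
    [x_i = 0] and [(D + E) x = nu x + (nu - mu) u].  The coordinate [i] of this
    equation gives [|nu - mu| <= eps |x|]; the other coordinates give
    [h |x| <= |E x| + |nu - mu| |u| <= 3 eps |x|], hence [x = 0]. *)
Lemma simple_eigenvalue_near (y z : 'cV[R[i]]_n) (mu nu : R[i]) (h : R) i :
  0 <= eps -> 3 * eps < h -> y != 0 -> z != 0 ->
  diag_mx d *m y + E *m y = mu *: y ->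
  diag_mx d *m z + E *m z = nu *: z ->
  (forall j, j != i -> h <= cmod (mu - d 0 j)) ->
  (forall j, j != i -> h <= cmod (nu - d 0 j)) -> mu = nu.
Proof.
move=> e0 eh y0 z0 ey ez hmu hnu.
have [u [ui ub eu]] := normalized_eigenvector e0 eh y0 ey hmu.
have [w [wi _ ew]] := normalized_eigenvector e0 eh z0 ez hnu.
have hh : 0 <= h by lra.
pose x := w - u.
have xi : x i 0 = 0 by rewrite !mxE wi ui subrr.
have ex : diag_mx d *m x + E *m x = nu *: x + (nu - mu) *: u.
  by rewrite /x !mulmxBr addrACA -opprD ew eu scalerBr scalerBl addrA subrK.
have dist : cmod (nu - mu) <= eps * l2norm x.
  apply: le_trans (hE x); apply: le_trans (cmod_le_l2norm _ i).
  by rewrite (residual_entry _ ex) xi mulr0 add0r mxE ui mulr1.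
have big : h * l2norm x <= l2norm (E *m x - (nu - mu) *: u).
  apply: le_l2norm_scale => // j; have [->|ji] := eqVneq j i.
    by rewrite xi cmod0 mulr0 cmod_ge0.
  rewrite [X in _ <= cmod X]mxE [X in _ + X]mxE (residual_entry _ ex) addrK cmodM.
  by rewrite ler_wpM2r ?cmod_ge0// hnu.
have tri := l2normD (E *m x) (- ((nu - mu) *: u)).
rewrite l2normN l2normZ in tri.
have drift : cmod (nu - mu) * l2norm u <= eps * l2norm x * 2.
  by apply: ler_pM; rewrite ?cmod_ge0 ?l2norm_ge0.
have x0 : l2norm x = 0.
  by have := hE x; have := l2norm_ge0 x; nra.
apply/esym/eqP; rewrite -subr_eq0 -cmod_eq0 eq_le cmod_ge0 andbT.
by rewrite x0 mulr0 in dist.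
Qed.
End Coordinates.

(** * Perturbation of a diagonalizable matrix *)

Section Perturbation.
Variables (R : realType) (n : nat) (A A' : 'M[R[i]]_n) (delta : R).
Hypothesis hAA' : specnorm (A - A') <= delta.

Lemma delta_ge0 : 0 <= delta.
Proof. exact: le_trans (specnorm_ge0 _) hAA'. Qed.

Lemma l2norm_perturbation (x : 'cV[R[i]]_n) : l2norm ((A' - A) *m x) <= delta * l2norm x.
Proof.
rewrite -opprB mulNmx l2normN; apply: le_trans (l2norm_mulmx _ _) _.
by rewrite ler_wpM2r ?l2norm_ge0.
Qed.

Section Basis.
Variables (V : 'M[R[i]]_n) (d : 'rV[R[i]]_n).
Hypothesis (UV : V \in unitmx) (eA : A = V *m diag_mx d *m invmx V).

Let E := invmx V *m (A' - A) *m V.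
Let k := specnorm V * specnorm (invmx V).

Lemma l2norm_conj (x : 'cV[R[i]]_n) : l2norm (E *m x) <= k * delta * l2norm x.
Proof.
rewrite /E -!mulmxA; apply: le_trans (l2norm_mulmx _ _) _.
have -> : k * delta * l2norm x = specnorm (invmx V) * (delta * (specnorm V * l2norm x)).
  rewrite /k; move: (specnorm V) (specnorm _) (l2norm _) => a b c; ring.
apply: ler_wpM2l; first exact: specnorm_ge0.
apply: le_trans (l2norm_perturbation _) _.
by rewrite ler_wpM2l ?delta_ge0 ?l2norm_mulmx.
Qed.

Lemma pencil_eigen (u : 'cV[R[i]]_n) (mu : R[i]) : A' *m u = mu *: u ->
  diag_mx d *m (invmx V *m u) + E *m (invmx V *m u) = mu *: (invmx V *m u).
Proof.
move=> eu; rewrite scalemxAr -eu /E -!mulmxA (mulKVmx UV) mulmxBl mulmxBr.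
by rewrite [in A *m u]eA -!mulmxA (mulKmx UV) addrC subrK.
Qed.

(** In the basis [V], [u] has coordinates [y], and [v] is a multiple of the column
    [V e_i].  Thus [V (y - y_i e_i)] is [u] minus a multiple of [v]; it is small
    because [|y - y_i e_i| <= |E y| / h], where [E y = V^-1 (A' - A) u] involves
    [V^-1] only, so that the whole bound has a single factor [|V| |V^-1|]. *)
Lemma eigenvector_near (u v : 'cV[R[i]]_n) (mu : R[i]) (h : R) i :
  0 < h -> eigenpair A' u mu -> eigenpair A v (d 0 i) ->
  (forall j, j != i -> d 0 j != d 0 i) ->
  (forall j, j != i -> h <= cmod (mu - d 0 j)) ->
  exists c, cmod c = 1 /\ l2norm (u - c *: v) <= 2 * (k * delta / h).
Proof.
move=> h0 [eu u1] [ev v1] di hd.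
set y := invmx V *m u; set z := invmx V *m v.
have ez : diag_mx d *m z = d 0 i *: z.
  by rewrite /z scalemxAr -ev eA -!mulmxA (mulKmx UV).
have zE : z = z i 0 *: delta_mx i 0.
  apply/colP => j; rewrite [RHS]mxE [X in _ * X]mxE eqxx andbT.
  have [->|ji] := eqVneq j i; first by rewrite mulr1.
  have /colP/(_ j) := ez; rewrite mul_diag_mx !mxE mulr0 => /eqP.
  by rewrite -subr_eq0 -mulrBl mulf_eq0 subr_eq0 (negPf (di j ji)) => /eqP.
have vz : v = z i 0 *: (V *m delta_mx i 0) by rewrite scalemxAr -zE mulKVmx.
have zi : z i 0 != 0.
  by apply: contraTneq (unit_vector_neq0 v1) => z0; rewrite negbK vz z0 scale0r.
have vE : V *m delta_mx i 0 = (z i 0)^-1 *: v.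
  by rewrite [in RHS]vz scalerA mulVf// scale1r.
have [c [c1 hc]] := phase_align (y i 0 * (z i 0)^-1) u1 v1.
exists c; split => //; apply: le_trans hc _; rewrite ler_pM2l//.
have -> : u - (y i 0 * (z i 0)^-1) *: v = V *m (y - y i 0 *: delta_mx i 0).
  by rewrite mulmxBr (mulKVmx UV) -scalemxAr vE scalerA.
apply: le_trans (l2norm_mulmx _ _) _.
rewrite /k -!mulrA ler_wpM2l ?specnorm_ge0// mulrA ler_pdivlMr// mulrC.
apply: le_trans (off_component (ltW h0) (pencil_eigen eu) hd) _.
rewrite /E -!mulmxA (mulKVmx UV); apply: le_trans (l2norm_mulmx _ _) _.
rewrite ler_wpM2l ?specnorm_ge0//.
by have := l2norm_perturbation u; rewrite u1 mulr1.
Qed.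

End Basis.

Lemma kappaV_ge0 : 0 <= kappaV A.
Proof.
rewrite /kappaV; set S := (X in inf X).
have [->|/set0P S0] := eqVneq S set0; first by rewrite inf0.
by apply: lb_le_inf => // _ [W _ <-]; rewrite mulr_ge0 ?specnorm_ge0.
Qed.

(** Positivity of [kappaV A] ensures that some diagonalizing basis exists, as the
    infimum of the empty set is 0. *)
Lemma kappaV_approx b : 0 < kappaV A -> kappaV A < b ->
  exists2 V, diagonalizes A V & specnorm V * specnorm (invmx V) < b.
Proof.
move=> k0 kb.
have S : has_inf [set specnorm V * specnorm (invmx V) | V in [set V | diagonalizes A V]]%classic.
  by apply: contrapT => /inf_out => e; move: k0; rewrite /kappaV e ltxx.
have [] := @inf_adherent _ _ (b - kappaV A) _ S; first by rewrite subr_gt0.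
by move=> _ [V dV <-]; rewrite -/(kappaV A) addrC subrK => h; exists V.
Qed.

Lemma le_kappaV_delta m : 0 < kappaV A ->
  (forall V, diagonalizes A V -> m <= specnorm V * specnorm (invmx V) * delta) ->
  m <= kappaV A * delta.
Proof.
move=> k0 hm; have d0 := delta_ge0; rewrite leNgt; apply/negP => lt.
have [d00|dn] := eqVneq delta 0.
  have [|V dV _] := @kappaV_approx (kappaV A + 1) k0; first by lra.
  by have := hm V dV; move: lt; rewrite d00 !mulr0; lra.
have dp : 0 < delta by rewrite lt_def dn.
have [|V dV] := @kappaV_approx (m / delta) k0; first by rewrite ltr_pdivlMr.
by rewrite ltr_pdivlMr// ltNge hm.
Qed.

(** Taking the eigenvalue of [A] closest to [mu] before choosing [V] makes the
    index independent of [V], so the bound passes to the infimum. *)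
Lemma bauer_fike_kappaV (v : 'I_n -> 'cV[R[i]]_n) (lam : 'I_n -> R[i])
    (u : 'cV[R[i]]_n) (mu : R[i]) : 0 < kappaV A ->
  (forall i, eigenpair A (v i) (lam i)) -> injective lam ->
  eigenpair A' u mu -> exists i, cmod (mu - lam i) <= kappaV A * delta.
Proof.
move=> k0 hv hlam [eu u1].
have [i0 _] : exists i : 'I_n, True.
  have := unit_vector_neq0 u1; case/matrix0Pn => i _; by exists i.
case: (@arg_minP _ _ _ i0 xpredT (fun i => cmod (mu - lam i)) isT) => i _ hi.
exists i; apply: le_kappaV_delta => // V [UV [d eA]].
have [t ht] := eigenvalues_of_diagonalization UV eA hv hlam.
apply: (bauer_fike (l2norm_conj V) (cmod_ge0 _) _ (pencil_eigen UV eA eu)).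
  apply: contra (unit_vector_neq0 u1) => /eqP y0.
  by rewrite -(mulKVmx UV u) y0 mulmx0.
by move=> j; rewrite -(permKV t j) ht hi.
Qed.

End Perturbation.

(** * Matching the eigenpairs *)

Theorem proposition1p1 (R : realType) (n : nat) (A A' : 'M[R[i]]_n) (delta : R)
    (v v' : 'I_n -> 'cV[R[i]]_n) (lam lam' : 'I_n -> R[i])
    (hA : specnorm A <= 1) (hA' : specnorm A' <= 1)
    (hAA' : specnorm (A - A') <= delta)
    (hv : forall i : 'I_n, eigenpair A (v i) (lam i))
    (hv' : forall i : 'I_n, eigenpair A' (v' i) (lam' i))
    (hlam : injective lam) (hlam' : injective lam')
    (hdelta : delta < gap A / (8%:R * kappaV A)) :
  exists (s : {perm 'I_n}) (c : 'I_n -> R[i]),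
    (forall i : 'I_n, cmod (c i) = 1) /\
    (forall i : 'I_n,
      [/\ l2norm (v' (s i) - c i *: v i) <= 2%:R * n%:R * kappa_eig A * delta,
          cmod (lam' (s i) - lam i) <= kappaV A * delta
        & kappaV A * delta <= 2%:R * kappa_eig A * delta]).
Proof.
have d0 := delta_ge0 hAA'.
(* A vanishing [kappaV A] would turn the upper bound on [delta] into
   [gap A / 0 = 0]. *)
have k0 : 0 < kappaV A.
  rewrite lt_def kappaV_ge0 andbT; apply: contraTneq hdelta => ->.
  by rewrite mulr0 invr0 mulr0 -leNgt.
have gd : 8 * (kappaV A * delta) < gap A.
  by move: hdelta; rewrite ltr_pdivlMr ?mulr_gt0// mulrC -mulrA.
have kd0 : 0 <= kappaV A * delta by rewrite mulr_ge0 ?(ltW k0).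
have g0 : 0 < gap A by apply: le_lt_trans gd; rewrite mulr_ge0.
have [i1 [j1 ij1]] := gap_gt0_distinct g0.
set eps := kappaV A * delta in kd0 gd *.
set g := gap A in g0 gd *.
have epsE : eps = kappaV A * delta by [].
have gE : g = gap A by [].
clearbody eps g.
have n2 : (2 <= n)%N by rewrite -(card_ord n); apply/card_gt1P; exists i1, j1.
have g2 : g <= 2.
  rewrite gE; apply: (le_trans (gap_le (hv i1) (hv j1) _)); first by rewrite (inj_eq hlam).
  apply: le_trans (cmodD _ _) _; rewrite cmodN (_ : 2 = 1 + 1)//.
  by apply: lerD; apply: le_trans hA; exact: eigenpair_le_specnorm (hv _).
(* [f j] is the eigenvalue of [A] closest to [lam' j]. *)
have /choice[f hf] j := bauer_fike_kappaV hAA' k0 hv hlam (hv' j).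
rewrite -epsE in hf *.
have [V [UV [d eA]]] : exists2 V, diagonalizes A V &
    specnorm V * specnorm (invmx V) < 3 / 2 * kappaV A.
  by apply: kappaV_approx => //; rewrite ltr_pMl//; clear; lra.
set k := _ * _ => hk.
have kE : k = specnorm V * specnorm (invmx V) by [].
clearbody k.
have [t ht] := eigenvalues_of_diagonalization UV eA hv hlam.
have kdel : k * delta <= 3 / 2 * eps.
  by rewrite epsE mulrA ler_wpM2r// ltW.
have kd0' : 0 <= k * delta by rewrite kE !mulr_ge0 ?specnorm_ge0.
(* [|lam' j - d_a| >= gap A - eps], and [eps <= gap A / 8]. *)
have far j a : a != t (f j) -> 7 / 8 * g <= cmod (lam' j - d 0 a).
  move=> ne.
  have ne' : lam ((t^-1)%g a) != lam (f j).
    by rewrite (inj_eq hlam); apply: contra ne => /eqP <-; rewrite permKV.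
  rewrite -[a](permKV t) ht.
  have := gap_le (hv _) (hv _) ne'; rewrite -gE cmodB.
  have := cmod_triangle (lam (f j)) (lam' j) (lam ((t^-1)%g a)).
  have := hf j; rewrite (cmodB (lam' j) (lam (f j))).
  move: (cmod _) (cmod _) (cmod _) => x y z; clear - gd; lra.
have finj : injective f.
  move=> a b fab; apply: hlam'.
  have nz w : l2norm w = 1 -> invmx V *m w != 0.
    move=> /unit_vector_neq0; apply: contra => /eqP y0.
    by rewrite -(mulKVmx UV w) y0 mulmx0.
  have [ea a1] := hv' a; have [eb b1] := hv' b.
  apply: (simple_eigenvalue_near (l2norm_conj hAA' V) _ _ (nz _ a1) (nz _ b1)
            (pencil_eigen UV eA ea) (pencil_eigen UV eA eb) (far a) _); rewrite -?kE//.
    by clear - gd kdel kd0; lra.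
  by rewrite fab; exact: far.
pose s := ((perm finj)^-1)%g.
have fs i : f (s i) = i by rewrite -{2}(permKV (perm finj) i) permE.
have dinj a b : a != b -> d 0 a != d 0 b.
  by rewrite -{2}(permKV t a) -{2}(permKV t b) !ht (inj_eq hlam) (inj_eq perm_inj).
have /choice[c hc] i : exists c, cmod c = 1 /\
    l2norm (v' (s i) - c *: v i) <= 2 * (k * delta / (7 / 8 * g)).
  rewrite kE.
  apply: (@eigenvector_near _ _ _ _ _ hAA' V d UV eA _ _ (lam' (s i)) _ (t i)) => //.
  - by clear - g0; lra.
  - by rewrite ht.
  - by move=> j; exact: dinj.
  - by move=> j ji; apply: far; rewrite fs.
exists s, c; split => [i|i]; first by have [] := hc i.
have ke : kappa_eig A * delta = eps / g by rewrite /kappa_eig -gE epsE mulrAC.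
have r0 : 0 <= eps / g by rewrite divr_ge0// ltW.
split.
- have [_ h] := hc i; apply: le_trans h _.
  rewrite -(mulrA _ (kappa_eig A)) ke.
  have nR : 2 <= n%:R :> R by rewrite (ler_nat _ 2).
  (* [2 (k delta) / (7/8 g) <= 24/7 eps / g <= 4 eps / g], and [4 <= 2 n]. *)
  apply: (@le_trans _ _ (4 * (eps / g))).
    have -> : 2 * (k * delta / (7 / 8 * g)) = (16 / 7) * (k * delta) / g.
      by field; rewrite gt_eqF.
    by rewrite mulrA ler_pM2r ?invr_gt0//; clear - kdel kd0; lra.
  by rewrite ler_wpM2r//; clear - nR; lra.
- by have := hf (s i); rewrite fs.
- by rewrite -(mulrA _ (kappa_eig A)) ke mulrA ler_pdivlMr// mulrC ler_wpM2r.
Qed.
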